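(* Let $X$ be a uniformly perfect metric space with more than one point, let $\Phi$ be an admissible function, let $F\subseteq X$ be non-empty and totally bounded, and let $s,a,c,\delta_0>0$ be positive constants. (i) If there exists a positive decreasing sequence $\delta_n\to0$ such that for each $n\in\mathbb{N}$ there exists a Borel measure $\mu_n$ with support $\mathrm{supp}(\mu_n)\subseteq F$ and $\mu_n(\mathrm{supp}(\mu_n))\ge a$, and such that for every Borel subset $U\subseteq X$ with $\Phi(\delta_n)\le|U|\le\delta_n$ we have $\mu_n(U)\le c|U|^s$, then $\overline{\dim}^\Phi F\ge s$. (ii) If, moreover, for all $\delta\in(0,\delta_0)$ there exists a Borel measure $\mu_\delta$ with support $\mathrm{supp}(\mu_\delta)\subseteq F$ and $\mu_\delta(\mathrm{supp}(\mu_\delta))\ge a$, and such that for every Borel subset $U\subseteq X$ with $\Phi(\delta)\le|U|\le\delta$ we have $\mu_\delta(U)\le c|U|^s$, then $\underline{\dim}^\Phi F\ge s$.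
   Context: For a subset $U$ of a metric space, $|U|$ denotes its diameter, and $B(x,r)$ is the open ball. Convention: $\inf\varnothing=\infty$. A metric space $X$ is uniformly perfect if there is $c'\in(0,1)$ such that $B(x,R)\setminus B(x,c'R)\neq\varnothing$ for all $x\in X$ and $0<R<|X|$. A set $F$ is totally bounded if for every $\delta>0$ it can be covered by finitely many open balls of radius $\delta/2$ with centres in $F$. A function $\Phi\colon(0,\Delta)\to\mathbb{R}$ (for some $\Delta>0$) is admissible if it is monotonic, $0<\Phi(\delta)\le\delta$ for all $\delta\in(0,\Delta)$, and $\Phi(\delta)/\delta\to0$ as $\delta\to0^+$. The scales $\delta_n$ and $\delta$ in the claim are taken in the domain of $\Phi$. For a non-empty totally bounded $F\subseteq X$ and admissible $\Phi$, the upper $\Phi$-intermediate dimension $\overline{\dim}^\Phi F$ is the infimum of all $s\ge0$ such that for all $\epsilon>0$ there exists $\delta_0\in(0,1]$ (with $(0,\delta_0)$ contained in the domain of $\Phi$) such that for all $\delta\in(0,\delta_0)$ there is a finite or countable cover $\{U_1,U_2,\dots\}$ of $F$ by subsets of $X$ with $\Phi(\delta)\le|U_i|\le\delta$ for all $i$ and $\sum_i|U_i|^s\le\epsilon$. The lower $\Phi$-intermediate dimension $\underline{\dim}^\Phi F$ is the infimum of all $s\ge0$ such that for all $\epsilon>0$ and $\delta_0\in(0,1]$ there exist $\delta\in(0,\delta_0)$ (in the domain of $\Phi$) and such a cover of $F$ with $\Phi(\delta)\le|U_i|\le\delta$ for all $i$ and $\sum_i|U_i|^s\le\epsilon$. 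*)

(* Defs.v *)
From HB Require Import structures.
From mathcomp Require Import all_boot all_order all_algebra.
From mathcomp Require Import all_classical all_reals all_analysis.

Set Implicit Arguments.
Unset Strict Implicit.
Unset Printing Implicit Defensive.

Import Order.TTheory GRing.Theory Num.Theory.
Import numFieldNormedType.Exports.

Local Open Scope classical_set_scope.
Local Open Scope ring_scope.

(* Measurable types are pointed in MathComp-Analysis, so the Borel sigma-algebra
   is put on metric spaces with a distinguished point; the point plays no other
   role. *)
#[short(type="pmetricType")]
HB.structure Definition PointedMetric (K : numDomainType) :=
  { M of Metric K M & isPointed M }.

Section metric.
Context {R : realType} {X : pmetricType R}.

(* The point 0 is adjoined so that the empty set has diameter 0 instead of
   -oo. *)
Definition diam (U : set X) : \bar R :=
  ereal_sup (0%E |` [set (mdist p.1 p.2)%:E | p in U `*` U]).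

Definition totally_bounded (F : set X) : Prop :=
  forall d : R, 0 < d -> exists A : set X,
    [/\ finite_set A, A `<=` F & F `<=` \bigcup_(x in A) ball x (d / 2)].

Definition uniformly_perfect : Prop :=
  exists c' : R, [/\ 0 < c', c' < 1 &
    forall (x : X) (r : R), 0 < r -> (r%:E < diam [set: X])%E ->
      ball x r `\` ball x (c' * r) !=set0].

End metric.
Arguments uniformly_perfect {R} X.

Notation borel X := (g_sigma_algebraType (@open X)).

Definition supp {R : realType} {X : pmetricType R}
    (mu : {measure set (borel X) -> \bar R}) : set X :=
  [set x | forall A : set X, open A -> A x -> (0 < mu A)%E].

(* A function on (0, Delta) is represented by a function on R of which only the
   values on (0, Delta) are ever used. *)
Definition admissible {R : realType} (Delta : R) (Phi : R -> R) : Prop :=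
  [/\ 0 < Delta,
      {in `]0, Delta[ &, {homo Phi : x y / x <= y}} \/
      {in `]0, Delta[ &, {homo Phi : x y /~ x <= y}},
      forall d : R, 0 < d < Delta -> 0 < Phi d <= d &
      Phi d / d @[d --> 0^'+] --> 0].

Section intermediate_dimension.
Context {R : realType} {X : pmetricType R}.
Variables (Delta : R) (Phi : R -> R) (F : set X).

(* The finite or countable cover is indexed by a set I of natural numbers. *)
Definition has_cover (s eps d : R) : Prop :=
  exists (I : set nat) (U : nat -> set X),
    [/\ F `<=` \bigcup_(i in I) U i,
        forall i, I i -> ((Phi d)%:E <= diam (U i) <= d%:E)%E &
        (\esum_(i in I) (diam (U i) `^ s) <= eps%:E)%E].

Definition upper_dim : \bar R :=
  ereal_inf [set s%:E | s in [set s : R | 0 <= s /\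
    forall eps : R, 0 < eps ->
      exists d0 : R, [/\ 0 < d0 <= 1, d0 <= Delta &
        forall d : R, 0 < d < d0 -> has_cover s eps d]]].

Definition lower_dim : \bar R :=
  ereal_inf [set s%:E | s in [set s : R | 0 <= s /\
    forall eps d0 : R, 0 < eps -> 0 < d0 <= 1 ->
      exists d : R, [/\ 0 < d < d0, d < Delta & has_cover s eps d]]].

End intermediate_dimension.

Definition mass_bound {R : realType} {X : pmetricType R} (Phi : R -> R)
    (F : set X) (s a c d : R) (mu : {measure set (borel X) -> \bar R}) : Prop :=
  [/\ supp mu `<=` F, (a%:E <= mu (supp mu))%E &
      forall U : set X, (@open X).-sigma.-measurable U ->
        ((Phi d)%:E <= diam U <= d%:E)%E ->
        (mu U <= c%:E * diam U `^ s)%E].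

(* Main.v *)
Require Import Defs.
From mathcomp Require Import all_boot all_order all_algebra.
From mathcomp Require Import all_classical all_reals all_analysis.
Import Order.TTheory GRing.Theory Num.Theory.
Import numFieldNormedType.Exports.
Local Open Scope classical_set_scope.
Local Open Scope ring_scope.

(** This is the mass distribution principle: if [U_1, U_2, ...] cover [F] and
    have diameters in [[Phi d, d]], then
    [a <= mu (supp mu) <= \sum_i mu (closure U_i) <= c * \sum_i |U_i| ^ s],
    so for [t <= s] and [d <= 1] the sums [\sum_i |U_i| ^ t] are bounded below by
    [a / c]. The [U_i] need not be Borel; their closures are, and have the same
    diameters, hence still lie in the range where the bound on [mu] applies. *)

(** Two points of the closure lie within [e / 2] of points [x'], [y'] of [U], so their distance
    exceeds [mdist x' y'] by at most [e], for every [e > 0]. *)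
Lemma diam_closure (R : realType) (X : pmetricType R) (U : set X) :
  diam (closure U) = diam U.
Proof.
apply/eqP; rewrite eq_le; apply/andP; split; last first.
  apply: ereal_sup_le => _ [->|[[x y] [/= Ux Uy] <-]]; first by left.
  by right; exists (x, y) => //; split; exact: subset_closure.
apply: ge_ereal_sup => _ [->|[[x y] /= [Ux Uy] <-]].
  by apply: ereal_sup_ubound; left.
apply/lee_addgt0Pr => e e0.
have e2 : 0 < e / 2 by rewrite divr_gt0.
have [x' [Ux' xx']] := Ux _ (nbhsx_ballx x _ e2).
have [y' [Uy' yy']] := Uy _ (nbhsx_ballx y _ e2).
move: xx' yy'; rewrite !ballEmdist /= => xx' yy'.
apply: (@le_trans _ _ ((mdist x' y')%:E + e%:E)%E).
  rewrite -EFinD lee_fin (le_trans (metric_triangle x x' y))//.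
  rewrite (le_trans (lerD (ltW xx') (metric_triangle x' y' y)))//.
  by rewrite (metric_sym y' y) addrCA [in leRHS](splitr e) lerD2l lerD2l ltW.
by rewrite leeD2r//; apply: ereal_sup_ubound; right; exists (x', y').
Qed.

Lemma borel_closed {R : realType} {X : pmetricType R} {A : set X} :
  closed A -> (@open X).-sigma.-measurable A.
Proof.
move=> cA; rewrite -(setCK A); apply: (@measurableC _ (borel X)).
by apply: sub_sigma_algebra; exact: closed_openC.
Qed.

(** A point outside the support has an open neighbourhood of measure zero, and this whole
    neighbourhood avoids the support. Hence [supp mu] is Borel. *)
Lemma closed_supp {R : realType} {X : pmetricType R}
    (mu : {measure set (borel X) -> \bar R}) : closed (supp mu).
Proof.
rewrite -openC openE => x /= /existsNP[A /not_implyP[oA /not_implyP[Ax muA]]].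
by apply: filterS (open_nbhs_nbhs (conj oA Ax)) => y Ay /(_ A oA Ay).
Qed.

Lemma mass_le {R : realType} {X : pmetricType R} {Phi : R -> R} {F : set X}
    {s t a c d eps : R} {mu : {measure set (borel X) -> \bar R}} :
  0 < c -> 0 < Phi d -> d <= 1 -> t <= s ->
  has_cover Phi F t eps d -> mass_bound Phi F s a c d mu -> a <= c * eps.
Proof.
move=> c0 Phi0 d1 ts [I [U [FU dU sU]]] [muF amu muU].
have msupp : measurable (supp mu : set (borel X)).
  by apply: borel_closed; exact: closed_supp.
(* Countable subadditivity runs over all of [nat], so indices outside [I] receive the empty set,
   which adds no mass. *)
pose V i : set (borel X) := if i \in I then closure (U i) else set0.
have mV i : measurable (V i).
  rewrite /V; case: ifPn => _ //.
  by apply: borel_closed; exact: closed_closure.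
have suppV : supp mu `<=` \bigcup_i V i.
  move=> x /muF /FU [i Ii Uix]; exists i => //.
  by rewrite /V mem_set//; exact: subset_closure.
have dge0 (i : nat) : I i -> (0 <= diam (U i) `^ t)%E.
  by move=> _; exact: poweR_ge0.
rewrite -lee_fin EFinM (le_trans amu)//.
rewrite (le_trans (measure_sigma_subadditive mu mV msupp suppV))//.
have -> : (\sum_(i <oo) mu (V i) = \sum_(i <oo | i \in I) mu (V i))%E.
  rewrite [RHS]eseries_mkcond; apply: eq_eseriesr => i _.
  by rewrite /V; case: ifPn => // _; rewrite measure0.
apply: (@le_trans _ _ (\sum_(i <oo | i \in I) (c%:E * diam (U i) `^ t))%E).
  apply: lee_nneseries => // i iI.
  have := dU i (set_mem iI); rewrite /V iI -{1 2}diam_closure => dUi.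
  rewrite (le_trans (muU _ (borel_closed (@closed_closure _ _)) dUi))//.
  rewrite diam_closure in dUi *.
  (* The range of [dUi] excludes infinite diameters and leaves [0 < r <= 1], where lowering the
     exponent from [s] to [t] can only increase the power. *)
  case: (diam (U i)) dUi => [r| |]; rewrite ?leye_eq ?leeNy_eq ?andbF//.
  rewrite !lee_fin => /andP[Pr rd]; rewrite ler_pM2l//.
  by rewrite ger_powR// (lt_le_trans Phi0)//= (le_trans rd).
rewrite nneseriesZl; last by move=> i /set_mem; exact: dge0.
rewrite lee_pmul2l//.
rewrite nneseries_esum; last by move=> i /set_mem; exact: dge0.
by rewrite set_mem_set.
Qed.

Theorem lemma5p1 (R : realType) (X : pmetricType R)
    (X_gt1 : exists x y : X, x <> y) (X_up : uniformly_perfect X)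
    (Delta : R) (Phi : R -> R) (Phi_adm : admissible Delta Phi)
    (F : set X) (F_neq0 : F !=set0) (F_tb : totally_bounded F)
    (s a c delta0 : R) (s_gt0 : 0 < s) (a_gt0 : 0 < a) (c_gt0 : 0 < c)
    (delta0_gt0 : 0 < delta0) :
  ((exists delta : nat -> R,
      [/\ nonincreasing_seq delta,
          forall n, 0 < delta n < Delta,
          delta n @[n --> \oo] --> 0 &
          forall n, exists mu : {measure set (borel X) -> \bar R},
            mass_bound Phi F s a c (delta n) mu]) ->
    (s%:E <= upper_dim Delta Phi F)%E) /\
  ((forall d : R, 0 < d < delta0 -> d < Delta ->
      exists mu : {measure set (borel X) -> \bar R},
        mass_bound Phi F s a c d mu) ->
    (s%:E <= lower_dim Delta Phi F)%E).
Proof.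
case: Phi_adm => [Delta_gt0 _ Phi_bnd _].
(* With this value [c * eps = a / 2 < a], which contradicts the conclusion of [mass_le]. *)
pose eps := a / 2 / c.
have eps_gt0 : 0 < eps by rewrite !divr_gt0.
have no_cover t d mu : t < s -> 0 < d < Delta -> d <= 1 ->
    mass_bound Phi F s a c d mu -> ~ has_cover Phi F t eps d.
  move=> ts dD d1 hmu hc; have /andP[Phi0 _] := Phi_bnd d dD.
  have := mass_le c_gt0 Phi0 d1 (ltW ts) hc hmu.
  by rewrite mulrC divfK ?gt_eqF// leNgt ltr_pdivrMr// ltr_pMr// ltr1n.
split.
- move=> [delta [_ deltaD delta_to0 hmu]].
  apply: le_ereal_inf_tmp => _ [t [t_ge0 ht] <-]; rewrite lee_fin leNgt.
  apply/negP => ts; have [d0 [/andP[d0_gt0 d0_le1] _ hd0]] := ht _ eps_gt0.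
  (* Covers exist at every scale below [d0], so one [delta n < d0] suffices for a contradiction;
     [d0 <= 1] gives [delta n <= 1]. *)
  have /cvgrPdist_lt /(_ d0 d0_gt0) [n _ /(_ n (leqnn n))] := delta_to0.
  have /andP[deltan_gt0 deltanD] := deltaD n.
  rewrite sub0r normrN gtr0_norm// => deltan_lt.
  have [mu hmun] := hmu n.
  apply: (no_cover t _ _ ts (deltaD n) _ hmun).
    exact: (le_trans (ltW deltan_lt)).
  by apply: hd0; rewrite deltan_gt0.
- move=> hmu; apply: le_ereal_inf_tmp => _ [t [t_ge0 ht] <-].
  rewrite lee_fin leNgt; apply/negP => ts.
  (* Below [delta0] every admissible scale carries a measure, so the one scale [d] at which a cover
     exists does too; the bound 1 serves the comparison of exponents. *)
  have [|d [/andP[d_gt0 d_lt] dD hc]] := ht eps (Num.min 1 delta0) eps_gt0.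
    by rewrite lt_min ltr01 delta0_gt0 ge_min lexx.
  move: d_lt; rewrite lt_min => /andP[d_lt1 d_lt].
  have [|mu hmud] := hmu d _ dD; first by rewrite d_gt0.
  by apply: (no_cover t d mu ts _ (ltW d_lt1) hmud hc); rewrite d_gt0.
Qed.
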